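(* Let $K$ be a finite regular CW complex, $L$ a subcomplex of $K$ such that $K$ collapses to $L$, and $f:L\to\mathbb{R}^k$ a multidimensional discrete Morse (MDM) function on $L$. Then $f$ can be extended to an MDM function $g:K\to\mathbb{R}^k$ on $K$ (i.e. $g|_L=f$) such that no cell in $K\setminus L$ is critical for $g$.
   Context: A finite regular CW complex $K$ is identified with its set of open cells; $K_p$ is the set of $p$-cells. For distinct cells, $\sigma\subset\tau$ means that $\sigma$ is contained in the closure of $\tau$. On $\mathbb{R}^k$, $a\preceq b$ means $a_i\le b_i$ for all $i$, and $a\prec b$ means $a\preceq b$ and $a\ne b$. Collapses. If $\sigma$ is a $p$-cell and $\tau$ a $(p+1)$-cell of $K$ with $\sigma\subset\tau$ and no other $(p+1)$-cell of $K$ has $\sigma$ as a face, then $(\sigma,\tau)$ is a collapse pair in $K$. $K$ collapses to a subcomplex $L$ if $L$ is obtained from $K$ by successively removing a finite sequence of collapse pairs (each being a collapse pair in the complex remaining at that stage). For $f:K\to\mathbb{R}^k$ (a function on cells) and $\sigma\in K_p$, put $H_f(\sigma)=\{\beta\in K_{p+1}:\beta\supset\sigma,\ f(\beta)\preceq f(\sigma)\}$ and $T_f(\sigma)=\{\alpha\in K_{p-1}:\alpha\subset\sigma,\ f(\alpha)\succeq f(\sigma)\}$. $f$ is an MDM function on $K$ if for every $p$ and every $\sigma\in K_p$: (1) $|H_f(\sigma)|\le 1$; (2) $|T_f(\sigma)|\le1$; (3) if $\beta\in K_{p+1}$, $\beta\supset\sigma$, $\beta\notin H_f(\sigma)$,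 then $f(\beta)\succ f(\sigma)$; (4) if $\alpha\in K_{p-1}$, $\alpha\subset\sigma$, $\alpha\notin T_f(\sigma)$, then $f(\alpha)\prec f(\sigma)$. A cell $\sigma$ is critical for $f$ if $|H_f(\sigma)|=|T_f(\sigma)|=0$. For a function on the cells of a subcomplex $L$, the same definitions are used with $L$ in place of $K$. *)

(* Defs.v *)
From HB Require Import structures.
From mathcomp Require Import all_boot all_order all_algebra.
From mathcomp Require Import all_classical all_reals all_analysis.
Import Order.TTheory GRing.Theory Num.Theory.
Import numFieldNormedType.Exports.

Set Implicit Arguments.
Unset Strict Implicit.
Unset Printing Implicit Defensive.

Local Open Scope classical_set_scope.
Local Open Scope ring_scope.

(* Euclidean balls; for n = 0 both balls are the one-point space 'rV_0 and the
   sphere is empty. *)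
Definition sqnorm (R : realType) (n : nat) (x : 'rV[R]_n) : R :=
  \sum_(i < n) x 0 i ^+ 2.

Definition closed_disk (R : realType) (n : nat) : set 'rV[R]_n :=
  [set x | sqnorm x <= 1].

Definition open_disk (R : realType) (n : nat) : set 'rV[R]_n :=
  [set x | sqnorm x < 1].

Definition sphere (R : realType) (n : nat) : set 'rV[R]_n :=
  [set x | sqnorm x = 1].

Definition homeomorphism_on (X Y : topologicalType) (A : set X) (B : set Y)
    (f : X -> Y) : Prop :=
  exists g : Y -> X,
    [/\ f @` A = B, {in A, cancel f g},
        {within A, continuous f} & {within B, continuous g}].

(* A finite CW structure on a Hausdorff space, in the sense of Whitehead, whose
   characteristic maps are homeomorphisms of closed disks onto closed cells.
   Since there are finitely many cells, closure-finiteness and the weak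
   topology are automatic. *)
Record finRegCW (R : realType) := FinRegCW {
  space : topologicalType;
  cells :> finType;
  dim : cells -> nat;
  open_cell : cells -> set space;
  char_map : forall c : cells, 'rV[R]_(dim c) -> space;
  space_hausdorff : hausdorff_space space;
  open_cell_cover : \bigcup_c open_cell c = setT;
  open_cell_disjoint : forall c d : cells,
    c != d -> open_cell c `&` open_cell d = set0;
  char_map_homeo : forall c : cells,
    homeomorphism_on (@closed_disk R (dim c)) (closure (open_cell c))
      (@char_map c);
  char_map_open_disk : forall c : cells,
    @char_map c @` @open_disk R (dim c) = open_cell c;
  char_map_sphere : forall c : cells,
    @char_map c @` @sphere R (dim c)
      `<=` \bigcup_(d in [set d | (dim d < dim c)%N]) open_cell d }.

Arguments dim {R f} c.
Arguments open_cell {R f} c _.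

Section Complex.
Variables (R : realType) (K : finRegCW R).
Implicit Types (S L : {set K}) (s t : K).

Definition subcomplex L : Prop :=
  forall c, c \in L ->
    closure (open_cell c) `<=` \bigcup_(d in [set d | d \in L]) open_cell d.

Definition face s t : bool :=
  (s != t) && `[< open_cell s `<=` closure (open_cell t) >].

Definition collapse_pair S s t : Prop :=
  [/\ s \in S, t \in S, dim t = (dim s).+1, face s t &
      forall b, b \in S -> dim b = (dim s).+1 -> face s b -> b = t].

Inductive collapses L : {set K} -> Prop :=
| collapses_refl : collapses L L
| collapses_step S s t :
    collapse_pair S s t -> collapses L (S :\: [set s; t]%SET) -> collapses L S.

Section MDM.
Variable k : nat.
Implicit Types (u v : 'rV[R]_k).

Definition vle u v : bool := [forall i, u 0 i <= v 0 i].
Definition vlt u v : bool := vle u v && (u != v).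

(* A function on the cells of S is represented by a total function f : K -> _
   of which only the values on S are used. *)
Implicit Type f : K -> 'rV[R]_k.

Definition Hset S f s : {set K} :=
  [set b in S | [&& dim b == (dim s).+1, face s b & vle (f b) (f s)]]%SET.

Definition Tset S f s : {set K} :=
  [set a in S | [&& dim s == (dim a).+1, face a s & vle (f s) (f a)]]%SET.

Definition MDM S f : Prop :=
  forall s, s \in S ->
  [/\ (#|Hset S f s| <= 1)%N,
      (#|Tset S f s| <= 1)%N,
      forall b, b \in S -> dim b = (dim s).+1 -> face s b ->
        b \notin Hset S f s -> vlt (f s) (f b) &
      forall a, a \in S -> dim s = (dim a).+1 -> face a s ->
        a \notin Tset S f s -> vlt (f a) (f s)].

Definition critical S f s : Prop :=
  [/\ s \in S, #|Hset S f s| = 0%N & #|Tset S f s| = 0%N].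

End MDM.
End Complex.

(* Main.v *)
(** All cells removed by the collapse get values above those of [f], constant
    along each collapse pair; since [L] is closed under faces, no removed cell
    is a face of a cell of [L].  Order the pairs lexicographically: first by the
    dimension [p] of the lower cell, then later removed before earlier removed.
    A facet relation between cells of two different pairs [(s, t)], [(s', t')]
    either raises [p] or has the form [s] facet of [t'] with equal [p]; in the
    latter case [(s, t)] is removed after [(s', t')], since [s] is a free face
    when it is removed.  So a function of the pair that strictly increases for
    this order is strictly monotone on unmatched facet relations. *)
Require Import Defs.
From mathcomp Require Import all_boot all_order all_algebra.
From mathcomp Require Import all_classical all_reals all_analysis.
From mathcomp Require Import zify.
Import Order.TTheory GRing.Theory Num.Theory.
Import numFieldNormedType.Exports.

Set Implicit Arguments.
Unset Strict Implicit.
Unset Printing Implicit Defensive.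

Local Open Scope ring_scope.

Section VectorOrder.
Variables (R : realType) (k : nat).
Implicit Types u v : 'rV[R]_k.

Lemma vle_refl u : vle u u.
Proof. by apply/forallP. Qed.

Lemma vlt_vleF u v : vlt u v -> vle v u = false.
Proof.
move=> /andP[/forallP le_uv ne_uv]; apply: contraNF ne_uv => /forallP le_vu.
apply/eqP/rowP => i.
by apply/eqP; rewrite eq_le le_uv le_vu.
Qed.

(** For [k = 0] all vectors coincide; one coordinate is needed to tell [u] from [v]. *)
Lemma vlt_pointwise u v : (0 < k)%N -> (forall i, u 0 i < v 0 i) -> vlt u v.
Proof.
move=> k_gt0 lt_uv; apply/andP; split.
  by apply/forallP => i; exact: ltW.
by apply/eqP => eq_uv; have := lt_uv (Ordinal k_gt0); rewrite eq_uv ltxx.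
Qed.

End VectorOrder.

Section Complex.
Variables (R : realType) (K : finRegCW R).
Local Notation dim := Defs.dim.
Implicit Types (S L : {set K}) (a b c s t : K).

Definition facet a b : bool := (dim b == (dim a).+1) && face a b.

Lemma facetI a b : dim b = (dim a).+1 -> face a b -> facet a b.
Proof. by move=> e; rewrite /facet e eqxx. Qed.

Lemma facet_dim a b : facet a b -> dim b = (dim a).+1.
Proof. by case/andP => /eqP. Qed.

Lemma facet_asym a b : facet a b -> facet b a = false.
Proof.
move=> /facet_dim e; apply/negP => /facet_dim.
by rewrite e; elim: (dim a) => // n IHn [].
Qed.

Lemma open_cell_nonempty c : exists x, open_cell c x.
Proof.
exists (@char_map R K c 0); rewrite -char_map_open_disk.
exists 0 => //; rewrite /open_disk /sqnorm /=.
by rewrite big1 ?ltr01 // => i _; rewrite mxE expr0n.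
Qed.

(** A point of [a] lies in the closure of [b], hence in some open cell of [L]; disjointness of open
    cells makes that cell [a]. *)
Lemma subcomplex_face L a b : subcomplex L -> face a b -> b \in L -> a \in L.
Proof.
move=> subL /andP[_ /asboolP le_ab] /subL clb.
have [x ax] := open_cell_nonempty a.
have [d /= dL dx] := clb _ (le_ab _ ax).
have [->//|ne_ad] := eqVneq a d.
by have /seteqP[/(_ x) /= [] //] := open_cell_disjoint ne_ad.
Qed.

Lemma collapses_sub L S : collapses L S -> L \subset S.
Proof. by elim=> // S' s t _ _ /fintype.subset_trans; apply; exact: subsetDl. Qed.

(** Induction on the collapse: [m] swaps the two cells of each removed pair, and [idx] is larger for
    pairs removed earlier. The inequality concerns a lower cell [a] and an upper cell [b]: since [a]
    is free when removed, [b] is already gone by then. *)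
Lemma collapses_matching L S : collapses L S ->
  exists (m : K -> K) (idx : K -> nat),
    (forall c, c \in S -> c \notin L ->
       [/\ m c \in S, m c \notin L, m (m c) = c, idx (m c) = idx c &
           facet c (m c) || facet (m c) c]) /\
    (forall a b, a \in S -> a \notin L -> b \in S -> b \notin L ->
       facet a b -> facet a (m a) -> facet (m b) b -> b != m a ->
       (idx a < idx b)%N).
Proof.
elim=> [|{}S s t [sS tS dim_t face_st free_s] coll [m [idx [mP idxP]]]].
  exists id, (fun=> 0%N); split=> [c -> //|a b -> //].
have facet_st : facet s t by exact: facetI.
have ne_ts : t != s.
  by apply/eqP => e; move: dim_t; rewrite e => /esym/eqP; rewrite eqn_leq ltnn.
have /fintype.subsetP subL := collapses_sub coll.
have sL : s \notin L by apply/negP => /subL; rewrite !inE eqxx.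
have tL : t \notin L by apply/negP => /subL; rewrite !inE eqxx orbT.
pose m' c := if c == s then t else if c == t then s else m c.
(* The pair removed first must exceed every index used in the smaller complex. *)
pose top := (\max_c idx c).+1.
pose idx' c := if (c == s) || (c == t) then top else idx c.
have m's : m' s = t by rewrite /m' eqxx.
have m't : m' t = s by rewrite /m' (negbTE ne_ts) eqxx.
exists m', idx'; split.
  move=> c cS cL.
  have [->|ne_cs] := eqVneq c s.
    by rewrite m's m't /idx' !eqxx orbT facet_st.
  have [->|ne_ct] := eqVneq c t.
    by rewrite m't m's /idx' !eqxx orbT facet_st orbT.
  have cS' : c \in (S :\: [set s; t])%SET by rewrite !inE negb_or ne_cs ne_ct.
  have [mcS mcL mmc idx_mc fc] := mP _ cS' cL.
  move: mcS; rewrite !inE negb_or => /andP[/andP[ne_ms ne_mt] mcS].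
  by rewrite /m' /idx' (negbTE ne_cs) (negbTE ne_ct) (negbTE ne_ms)
    (negbTE ne_mt).
move=> a b aS aL bS bL fab fama fmbb ne_bma.
(* As [s] is free in [S], it is a facet of [t = m' s] only. *)
have ne_as : a != s.
  apply/eqP => e; subst a; case/eqP: ne_bma; rewrite m's.
  by case/andP: fab => /eqP dim_b face_b; exact: free_s.
(* Here [a] is the lower and [b] the upper cell of its pair, which excludes [a = t] and [b = s]. *)
have ne_at : a != t.
  apply/eqP => e; subst a.
  by move: fama; rewrite m't facet_asym.
have ne_bs : b != s.
  apply/eqP => e; subst b.
  by move: fmbb; rewrite m's facet_asym.
rewrite /idx' (negbTE ne_as) (negbTE ne_at) (negbTE ne_bs) /=.
case: eqVneq => [_|ne_bt]; first by rewrite ltnS; exact: leq_bigmax.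
apply: idxP => //.
- by rewrite !inE negb_or ne_as ne_at.
- by rewrite !inE negb_or ne_bs ne_bt.
- by move: fama; rewrite /m' (negbTE ne_as) (negbTE ne_at).
- by move: fmbb; rewrite /m' (negbTE ne_bs) (negbTE ne_bt).
- by move: ne_bma; rewrite /m' (negbTE ne_as) (negbTE ne_at).
Qed.

(** The lexicographic order is packed into one number: [low] is the leading digit and [idx] the last
    digit in base [N]. *)
Lemma collapses_height L S : collapses L S ->
  exists (m : K -> K) (h : K -> nat),
    (forall c, c \in S -> c \notin L ->
       [/\ m c \in S, m c \notin L, m (m c) = c, h (m c) = h c &
           facet c (m c) || facet (m c) c]) /\
    (forall a b, a \in S -> a \notin L -> b \in S -> b \notin L ->
       facet a b -> b != m a -> (h a < h b)%N).
Proof.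
move=> /collapses_matching[m [idx [mP idxP]]].
(* For a removed cell, this is the dimension of the lower cell of its pair. *)
pose low c := minn (dim c) (dim (m c)).
pose N := (\max_c idx c).+1.
have idx_lt c : (idx c < N)%N by rewrite ltnS; exact: leq_bigmax.
exists m, (fun c => (low c * N + idx c)%N); split.
  move=> c cS cL; have [mS mL mmc -> fc] := mP _ cS cL.
  by split=> //; rewrite /low mmc minnC.
move=> a b aS aL bS bL fab ne_bma.
have low_lt : (low a < low b)%N -> (low a * N + idx a < low b * N + idx b)%N.
  move=> lt_ab; apply: (@leq_trans ((low a).+1 * N)).
    by rewrite mulSn addnC ltn_add2r.
  by rewrite (leq_trans _ (leq_addr _ _)) // leq_mul2r lt_ab orbT.
have dim_ab := facet_dim fab.
have [_ _ _ _ /orP fa] := mP _ aS aL.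
have [_ _ _ _ /orP fb] := mP _ bS bL.
(* Only a lower cell [a] below an upper cell [b] leaves [low] unchanged; in the other three cases it
   grows. *)
case: fa fb => [fa|fa] [fb|fb]; have da := facet_dim fa; have db := facet_dim fb.
- by apply: low_lt; rewrite /low; move: dim_ab da db; clear; lia.
- have -> : low a = low b by rewrite /low; move: dim_ab da db; clear; lia.
  by rewrite ltn_add2l; exact: idxP.
- by apply: low_lt; rewrite /low; move: dim_ab da db; clear; lia.
- by apply: low_lt; rewrite /low; move: dim_ab da db; clear; lia.
Qed.

End Complex.

Lemma row_family_bound (R : realType) (k : nat) (I : finType)
    (f : I -> 'rV[R]_k) : exists M : R, forall c i, f c 0 i < M.
Proof.
exists (1 + \sum_c \sum_i `|f c 0 i|) => c i.
rewrite (le_lt_trans (ler_norm _)) // ltr_pwDl //.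
rewrite (bigD1 c) //= (bigD1 i) //= -addrA lerDl.
by rewrite addr_ge0 ?sumr_ge0 // => j _; rewrite sumr_ge0.
Qed.

Theorem lemma2p11 (R : realType) (k : nat) (K : finRegCW R) (L : {set K})
    (f : K -> 'rV[R]_k) :
  (0 < k)%N -> subcomplex L -> collapses L [set: K]%SET -> MDM L f ->
  exists g : K -> 'rV[R]_k,
    [/\ MDM [set: K]%SET g,
        forall s, s \in L -> g s = f s &
        forall s, s \notin L -> ~ critical [set: K]%SET g s].
Proof.
move=> k_gt0 subL /collapses_height[m [h [mP hP]]] mdm_f.
have [M fM] := row_family_bound f.
(* [M] lifts the removed cells above all values of [f]; partners have equal height, hence equal
   vectors. *)
pose g c : 'rV[R]_k := if c \in L then f c else const_mx (M + (h c)%:R).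
have gL c : c \in L -> g c = f c by rewrite /g => ->.
have gm c : c \notin L -> g (m c) = g c.
  move=> cL; have [_ mL _ hm _] := mP c (finset.in_setT _) cL.
  by rewrite /g (negbTE cL) (negbTE mL) hm.
have g_lt a b : facet a b -> b \notin L -> (a \notin L -> b != m a) ->
    vlt (g a) (g b).
  move=> fab bL ne_bma; apply: vlt_pointwise => // i.
  rewrite /g (negbTE bL) [in X in _ < X]mxE; case: ifPn => aL.
    by rewrite (lt_le_trans (fM a i)) // lerDl.
  by rewrite mxE ltrD2l ltr_nat hP ?finset.in_setT // ne_bma.
have inH s b : (b \in Hset [set: K]%SET g s) = facet s b && vle (g b) (g s).
  by rewrite !inE /= andbA.
have inT s a : (a \in Tset [set: K]%SET g s) = facet a s && vle (g s) (g a).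
  by rewrite !inE /= andbA.
have facet_down a b : facet a b -> b \in L -> a \in L.
  by case/andP => _; exact: subcomplex_face.
(* New cofaces have strictly larger values and there are no new facets, so both sets of a cell of
   [L] are unchanged. *)
have Hset_L s : s \in L -> Hset [set: K]%SET g s = Hset L f s.
  move=> sL; apply/finset.setP => b; rewrite inH inE /=.
  case: (boolP (b \in L)) => bL; first by rewrite !gL // /facet -andbA.
  by apply/negbTE/negP => /andP[fsb]; rewrite vlt_vleF // g_lt // sL.
have Tset_L s : s \in L -> Tset [set: K]%SET g s = Tset L f s.
  move=> sL; apply/finset.setP => a; rewrite inT inE /=.
  case: (boolP (a \in L)) => aL; first by rewrite !gL // /facet -andbA.
  by apply/negbTE/negP => /andP[/facet_down/(_ sL)]; rewrite (negbTE aL).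
(* Strict growth off the matching leaves the partner as the only candidate. *)
have Hset_m s b : s \notin L -> b \in Hset [set: K]%SET g s -> b = m s.
  move=> sL; rewrite inH => /andP[fsb le_bs]; apply: contraTeq le_bs => ne_b.
  by rewrite vlt_vleF // g_lt //; apply: contra sL; exact: facet_down.
have Tset_m s a : s \notin L -> a \in Tset [set: K]%SET g s -> a = m s.
  move=> sL; rewrite inT => /andP[fas]; apply: contraTeq => ne_a.
  (* If [s = m a], the involution gives [a = m s]. *)
  rewrite vlt_vleF // g_lt // => aL; apply: contra ne_a => /eqP ->.
  by have [_ _ -> _ _] := mP a (finset.in_setT _) aL.
exists g; split=> // s; last first.
  (* The partner has the same value, so it lies in one of the two sets. *)
  move=> sL [_ /eqP H0 /eqP T0].
  have [_ _ _ _ /orP[fs|fs]] := mP s (finset.in_setT _) sL.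
    move: H0; rewrite finset.cards_eq0 => /eqP/finset.setP/(_ (m s)).
    by rewrite inH fs gm // vle_refl inE.
  move: T0; rewrite finset.cards_eq0 => /eqP/finset.setP/(_ (m s)).
  by rewrite inT fs gm // vle_refl inE.
move=> _; case: (boolP (s \in L)) => sL.
  have [H1 T1 H3 T4] := mdm_f s sL.
  rewrite Hset_L // Tset_L //; split=> // [b _ dim_b fsb|a _ dim_s fas].
    case: (boolP (b \in L)) => bL; first by rewrite !gL //; exact: H3.
    by move=> _; rewrite g_lt ?facetI // sL.
  have aL := facet_down _ _ (facetI dim_s fas) sL.
  by rewrite !gL //; exact: T4.
have card_le1 (A : {set K}) :
    (forall c, c \in A -> c = m s) -> (#|A| <= 1)%N.
  move=> Am; rewrite -(finset.cards1 (m s)) subset_leq_card //.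
  by apply/fintype.subsetP => c /Am ->; rewrite inE.
split=> [||b _ dim_b fsb|a _ dim_s fas].
- by apply: card_le1 => b; exact: Hset_m.
- by apply: card_le1 => a; exact: Tset_m.
(* A coface outside the H-set cannot be the partner, whose value is equal, so [g_lt] applies;
   likewise for facets. *)
- rewrite inH facetI //= => nle_bs; apply: g_lt; rewrite ?facetI //.
    by apply: contra sL; apply: facet_down; exact: facetI.
  by move=> _; apply: contra nle_bs => /eqP ->; rewrite gm // vle_refl.
- rewrite inT facetI //= => nle_sa; apply: g_lt; rewrite ?facetI // => aL.
  by apply: contra nle_sa => /eqP ->; rewrite gm // vle_refl.
Qed.
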